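(* Consider the symmetric Ehrenfest chain with $n\ge1$ balls and put $\theta(t)=\arccos(e^{-2t})$ for $t\ge0$. Then $\cos\theta(t)=e^{-2t}$ is the relaxation factor of the slowest non-constant mode of the chain, whose generator eigenvalue is $-2$. Moreover $\theta(t)/2$ is a statistical angle: if $q_t=(p(t),1-p(t))$ with $p(t)=\tfrac12(1+e^{-2t})$ is the law at time $t$ of one ball started in urn $a$ and $\delta_a=(1,0)$, then $$\mathrm{BC}(\delta_a,q_t)=\sqrt{p(t)},\qquad \arccos\mathrm{BC}(\delta_a,q_t)=\arccos\sqrt{p(t)}=\frac{\theta(t)}2 .$$
   Context: The symmetric Ehrenfest urn with $n$ balls is the continuous-time Markov chain on $\{0,\dots,n\}$ with generator $Q_{k,k-1}=k$, $Q_{k,k+1}=n-k$, $Q_{kk}=-n$, all other entries zero; equivalently each of $n$ independent balls changes urn ($a\leftrightarrow b$) at rate $1$ and $k$ counts the balls in $a$. A mode with generator eigenvalue $-\gamma$ has relaxation factor $e^{-\gamma t}$; ''the slowest non-constant mode'' is the one corresponding to the largest nonzero eigenvalue of $Q$. The Bhattacharyya coefficient of two probability vectors is $\mathrm{BC}(p,q)=\sum_i\sqrt{p_iq_i}$, and $\arccos\mathrm{BC}(p,q)$ is called the statistical angle. *)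

(* Defs.v *)
From HB Require Import structures.
From mathcomp Require Import all_boot all_order all_algebra.
From mathcomp Require Import all_classical all_reals all_analysis.
From mathcomp Require Import complex.
Set Implicit Arguments.
Unset Strict Implicit.
Unset Printing Implicit Defensive.
Import Order.TTheory GRing.Theory Num.Theory.
Import numFieldNormedType.Exports.
Local Open Scope classical_set_scope.
Local Open Scope ring_scope.

Definition ehrenfest (R : realType) (n : nat) : 'M[R]_n.+1 :=
  \matrix_(k, l)
    if l.+1 == k :> nat then k%:R
    else if l == k.+1 :> nat then n%:R - k%:R
    else if l == k then - n%:R
    else 0.

(* Eigenvalues range over the complex numbers. The order on [R[i]] compares only
   numbers with the same imaginary part, so the last clause says that every
   nonzero complex eigenvalue is real and at most [lam]. *)
Definition largest_nonzero_eigenvalue (R : realType) (n : nat)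
    (Q : 'M[R]_n) (lam : R) : Prop :=
  [/\ eigenvalue Q lam, lam != 0 &
      forall mu : R[i], eigenvalue (map_mx (real_complex R) Q) mu ->
        mu != 0 -> mu <= (lam%:C)%C].

(* Modes are eigenfunctions of the generator, hence column vectors: the constant
   function is the mode of eigenvalue 0. *)
Definition mode (R : realType) (n : nat) (Q : 'M[R]_n) (gamma : R)
    (f : 'cV[R]_n) : Prop :=
  f != 0 /\ Q *m f = (- gamma) *: f.

Definition slowest_nonconstant_mode (R : realType) (n : nat) (Q : 'M[R]_n)
    (gamma : R) (f : 'cV[R]_n) : Prop :=
  mode Q gamma f /\ largest_nonzero_eigenvalue Q (- gamma).

Definition relaxation_factor (R : realType) (gamma t : R) : R :=
  expR (- gamma * t).

Definition matrix_exp (R : realType) (m : nat) (A : 'M[R]_m.+1) : 'M[R]_m.+1 :=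
  limn (series (fun k : nat => (k`!%:R)^-1 *: A ^+ k)).

Definition ctmc_law (R : realType) (m : nat) (Q : 'M[R]_m.+1)
    (mu : 'rV[R]_m.+1) (t : R) : 'rV[R]_m.+1 :=
  mu *m matrix_exp (t *: Q).

(* The two urns as states of a single ball, in the order (a, b). *)
Definition urn_a : 'I_2 := ord0.

Definition ball_generator (R : realType) : 'M[R]_2 :=
  \matrix_(i, j) if i == j then -1 else 1.

Definition delta_a (R : realType) : 'rV[R]_2 := delta_mx 0 urn_a.

Definition ball_law (R : realType) (t : R) : 'rV[R]_2 :=
  ctmc_law (ball_generator R) (delta_a R) t.

Definition prob_vector (R : realType) (m : nat) (p : 'rV[R]_m) : Prop :=
  (forall i, 0 <= p 0 i) /\ \sum_i p 0 i = 1.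

Definition BC (R : realType) (m : nat) (p q : 'rV[R]_m) : R :=
  \sum_i Num.sqrt (p 0 i * q 0 i).

Definition statistical_angle (R : realType) (m : nat) (p q : 'rV[R]_m) : R :=
  acos (BC p q).

Definition stay_prob (R : realType) (t : R) : R := (1 + expR (- (2 * t))) / 2.

Definition theta (R : realType) (t : R) : R := acos (expR (- (2 * t))).

(* Main.v *)
Require Import Defs.
From mathcomp Require Import all_boot all_order all_algebra.
From mathcomp Require Import all_classical all_reals all_analysis.
From mathcomp Require Import complex ring lra zify.
Import Order.TTheory GRing.Theory Num.Theory.
Import numFieldNormedType.Exports.
Local Open Scope ring_scope.

(** Encode a row vector [v] by its generating polynomial [p = sum_k v_k X^k].
Right multiplication by the Ehrenfest generator [Q] then becomes the first-order
operator
<<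
  L p = (1 - X) * ((1 + X) * p' - n p).
>>
Both spectral facts are read off at the point [X = 1].

If [L p = mu p] and [p = q * (X - 1)^j] with [q(1) <> 0], dividing by
[(X - 1)^j] and evaluating at [1] leaves [mu q(1) = - 2 j q(1)], so every
eigenvalue, over any field, is [- 2 j] for a natural [j]
([eigenvalue_ehrenfest]). In particular the nonzero complex eigenvalues are
real and at most [- 2].

Conversely [- 2] occurs, with eigenfunction the imbalance [k |-> n - 2k] between
the two urns: pairing [v] with it gives [phi(p) = n p(1) - 2 p'(1)], and as the
factor [1 - X] of [L p] vanishes at [1], [phi(L p) = - 2 phi(p)]
([ehrenfest_imbalance]).

For one ball, [t] times the generator is [- 2t] times the projection [P] with
rows [(1/2, - 1/2)] and [(- 1/2, 1/2)]. The exponential series of [a P], for an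
idempotent [P], is the scalar exponential series on the range of [P] and that of
[0] on its kernel, so it sums to [1 + (exp a - 1) P]
([matrix_exp_scale_proj]); this yields the law [(p(t), 1 - p(t))]. The
angle identity is the half-angle formula [cos (y / 2)^2 = (1 + cos y) / 2] for
[y = theta t], where [y / 2] lies in [[0, pi / 2]] so that its cosine is
nonnegative and [acos] inverts it. *)

(** * Spectrum of the Ehrenfest generator *)

(** Taking an arbitrary field lets the real eigenvectors and the complex
eigenvalues be handled together. *)
Definition ehrenfest_mx (K : fieldType) (n : nat) : 'M[K]_n.+1 :=
  \matrix_(k, l)
    if l.+1 == k :> nat then k%:R
    else if l == k.+1 :> nat then n%:R - k%:R
    else if l == k then - n%:R
    else 0.

(** The predecessor in [k.-1] is truncated, which is harmless: at [k = 0] that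
term has coefficient [0]. Dually, the term in ['X^n.+1] vanishes at [k = n],
which keeps the right-hand side within the size of a row. *)
Lemma rVpoly_row_ehrenfest (K : fieldType) (n : nat) (k : 'I_n.+1) :
  rVpoly (row k (ehrenfest_mx K n)) =
  k%:R *: ('X^(k.-1) : {poly K}) + (n%:R - k%:R) *: 'X^(k.+1) - n%:R *: 'X^k.
Proof.
apply/polyP => l; rewrite coefB coefD !coefZ !coefXn.
have [lt_ln|le_nl] := ltnP l n.+1.
  rewrite (coef_rVpoly_ord (row k _) (Ordinal lt_ln)) !mxE -val_eqE /=.
  case: k => k /= _.
  have [->|nk1] := eqVneq k l.+1.
    have -> : (l == l.+2) = false by lia.
    have -> : (l == l.+1) = false by lia.
    by rewrite eqxx /=; ring.
  have [->|nk2] := eqVneq l k.+1.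
    have -> : (k.+1 == k.-1) = false by lia.
    have -> : (k.+1 == k) = false by lia.
    by rewrite /=; ring.
  have [->|nk] := eqVneq l k; last first.
    have -> : (l == k.-1) = false by lia.
    by rewrite /=; ring.
  case: k {nk1 nk2} => [|k]; first by rewrite /=; ring.
  have -> : (k.+1 == k.+1.-1) = false by lia.
  by rewrite /=; ring.
rewrite nth_default; last by rewrite (leq_trans (size_poly _ _)).
case: k => k /= lt_kn.
rewrite (_ : (l == k.-1) = false) 1?(_ : (l == k) = false); try lia.
have [El|_] := eqVneq l k.+1; last by ring.
by rewrite (_ : n = k); [ring | lia].
Qed.

(** The generator as a differential operator on generating polynomials; the
factor [1 - 'X], which is responsible for everything that follows, reflects that
the rows of the generator sum to zero. *)
Lemma rVpoly_mul_ehrenfest (K : fieldType) (n : nat) (v : 'rV[K]_n.+1) :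
  rVpoly (v *m ehrenfest_mx K n) =
  (1 - 'X) * ((1 + 'X) * (rVpoly v)^`() - n%:R *: rVpoly v).
Proof.
rewrite mulmx_sum_row [in RHS](row_sum_delta v) !raddf_sum /=.
rewrite mulr_sumr -big_split mulr_sumr /=; apply: eq_bigr => k _.
rewrite !linearZ /= rVpoly_row_ehrenfest rVpoly_delta derivXn.
rewrite -!mul_polyC !polyCB !polyC_natr -mulr_natl.
case: (k : nat) => [|j] /=; first by rewrite expr0 expr1; ring.
rewrite !exprS; ring.
Qed.

(** The eigenvalue is determined by the order [j] at which the generating
polynomial of the eigenvector vanishes at [1]: the operator preserves that order
and multiplies the leading Taylor coefficient there by [- 2 j]. *)
Lemma eigenvalue_ehrenfest (K : fieldType) (n : nat) (mu : K) :
  eigenvalue (ehrenfest_mx K n) mu -> exists j : nat, mu = - (2 * j%:R).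
Proof.
case/eigenvalueP => v vQ v0.
have p0 : rVpoly v != 0.
  apply: contra_neq v0 => p0; apply: (can_inj rVpolyK).
  by rewrite p0 linear0.
have Ep := rVpoly_mul_ehrenfest _ _ v; rewrite vQ linearZ /= in Ep.
have [j [q]] := multiplicity_XsubC (rVpoly v) 1; rewrite p0 /= => q1 Eq.
exists j; move: Ep; rewrite Eq polyC1 => Ep.
have Y0 : ('X - 1 : {poly K}) ^+ j != 0.
  by rewrite expf_neq0 // -polyC1 polyXsubC_eq0.
have Eq' : mu *: q =
    (1 - 'X) * ((1 + 'X) * q^`() - n%:R *: q) - (1 + 'X) * (j%:R *: q).
  (* The order [j] must be split: [deriv_exp] produces the exponent [j.-1]. *)
  apply: (mulIf Y0); rewrite -scalerAl Ep derivM deriv_exp derivB derivX.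
  rewrite -polyC1 derivC subr0 mul1r -!mul_polyC !polyC_natr -mulr_natl.
  rewrite !polyC1; case: (j) => [|i]; first by rewrite expr0; ring.
  by rewrite exprS /=; ring.
have /eqP := congr1 (horner^~ 1) Eq'.
rewrite !hornerE /= subrr mul0r sub0r.
by rewrite -mulNr (inj_eq (mulIf q1)) => /eqP.
Qed.

(** [eigenvalue] refers to row vectors, whereas modes are columns; a square
matrix that kills a nonzero column is singular, hence also kills a nonzero
row. *)
Lemma eigenvalue_col (K : fieldType) (n : nat) (A : 'M[K]_n) (a : K)
    (f : 'cV[K]_n) :
  f != 0 -> A *m f = a *: f -> eigenvalue A a.
Proof.
move=> f0 Af; apply: contraNT f0.
rewrite /eigenvalue negbK /eigenspace kermx_eq0 row_free_unit => Au.
by rewrite -(mulKmx Au f) mulmxBl Af mul_scalar_mx subrr mulmx0.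
Qed.

Lemma map_ehrenfest (R : realType) (n : nat) :
  map_mx (real_complex R) (ehrenfest R n) = ehrenfest_mx R[i] n.
Proof.
by apply/matrixP => k l; rewrite !mxE; do 3?case: ifP => _;
  rewrite ?(rmorphN, rmorphB, rmorph_nat, rmorph0).
Qed.

Definition imbalance (K : fieldType) (n : nat) : 'cV[K]_n.+1 :=
  \col_k (n%:R - 2 * k%:R).

(** As [n - 2k] is affine in [k], pairing with the imbalance only involves
the total mass [p(1)] and the mean [p'(1)] of the generating polynomial. *)
Lemma mul_imbalance (K : fieldType) (n : nat) (v : 'rV[K]_n.+1) :
  (v *m imbalance K n) 0 0 =
  n%:R * (rVpoly v).[1] - 2 * (rVpoly v)^`().[1].
Proof.
rewrite [in RHS](row_sum_delta v) !linear_sum /= !horner_sum !mulr_sumr.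
rewrite -sumrB mxE; apply: eq_bigr => k _.
rewrite mxE !linearZ /= rVpoly_delta derivXn !hornerE hornerMn !hornerXn !expr1n.
by rewrite /=; ring.
Qed.

(** Each ball contributes [1] or [- 1] to the imbalance and changes sign at rate
[1], so the imbalance decays at rate [2]. *)
Lemma ehrenfest_imbalance (K : fieldType) (n : nat) :
  ehrenfest_mx K n *m imbalance K n = (- 2) *: imbalance K n.
Proof.
apply/row_matrixP => k; rewrite !rowE mulmxA -scalemxAr.
apply/rowP => i; rewrite (ord1 i) [in RHS]mxE !mul_imbalance.
rewrite rVpoly_mul_ehrenfest derivM derivB derivX derivC !hornerE /=.
by ring.
Qed.

Lemma mode_imbalance (R : realType) (n : nat) : (1 <= n)%N ->
  mode (ehrenfest R n) 2 (imbalance R n).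
Proof.
move=> n0; split; last exact: ehrenfest_imbalance.
apply/eqP => /matrixP /(_ ord0 ord0); rewrite !mxE mulr0 subr0.
by move/eqP; rewrite pnatr_eq0; apply/negP; rewrite -lt0n.
Qed.

Lemma largest_ehrenfest (R : realType) (n : nat) : (1 <= n)%N ->
  largest_nonzero_eigenvalue (ehrenfest R n) (-2).
Proof.
move=> n0; split.
- have [f0 fQ] := mode_imbalance R n n0; exact: eigenvalue_col f0 fQ.
- by rewrite oppr_eq0 pnatr_eq0.
move=> mu; rewrite map_ehrenfest => /eigenvalue_ehrenfest [[|j] ->].
  by rewrite mulr0 oppr0 eqxx.
move=> _; rewrite -[2]/(2%:R) -[j.+1%:R](rmorph_nat (real_complex R)).
rewrite -[2%:R in leLHS](rmorph_nat (real_complex R)) -rmorphM -rmorphN lecR.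
by rewrite lerN2 ler_peMr // ler1n.
Qed.

(** What pins down the rate of a slowest mode, hence its relaxation factor. *)
Lemma largest_nonzero_eigenvalue_unique (R : realType) (n : nat)
    (Q : 'M[R]_n) (a b : R) :
  largest_nonzero_eigenvalue Q a -> largest_nonzero_eigenvalue Q b -> a = b.
Proof.
have le (x y : R) : largest_nonzero_eigenvalue Q x ->
    largest_nonzero_eigenvalue Q y -> x <= y.
  move=> [Qx x0 _] [_ _ maxy]; rewrite -lecR; apply: maxy.
    by rewrite eigenvalue_map.
  by rewrite fmorph_eq0.
by move=> Qa Qb; apply/eqP; rewrite eq_le !le.
Qed.

(** * One ball and the statistical angle *)

(** On the range of an idempotent [P] the matrix [a *: P] acts as [a], and on its
kernel as [0]; the exponential series splits accordingly. *)
Lemma matrix_exp_scale_proj (R : realType) (m : nat) (a : R) (P : 'M[R]_m.+1) :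
  P * P = P -> matrix_exp (a *: P) = 1 + (expR a - 1) *: P.
Proof.
move=> PP.
have PX k : (a *: P) ^+ k =
    (0 : R) ^+ k *: (1 - P) + a ^+ k *: P.
  elim: k => [|k IHk]; first by rewrite !expr0 !scale1r subrK.
  rewrite exprS IHk expr0n mulrDr -!scalerAr -!scalerAl mulrBr mulr1 PP subrr.
  by rewrite !scaler0 add0r expr0n /= scale0r add0r scalerA mulrC -exprS.
have cvg_exp (x : R) : (series (exp_coeff x) @ \oo --> expR x)%classic.
  exact: is_cvg_series_exp_coeff.
rewrite /matrix_exp.
have -> : series (fun k => (k`!%:R)^-1 *: (a *: P) ^+ k) =
    (fun N => series (exp_coeff 0) N *: (1 - P) + series (exp_coeff a) N *: P).
  apply/funext => N; rewrite /series /= !scaler_suml -big_split /=.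
  by apply: eq_bigr => k _; rewrite PX scalerDr !scalerA !exp_coeffE.
apply: cvg_lim; first exact: norm_hausdorff.
have -> : 1 + (expR a - 1) *: P = expR 0 *: (1 - P) + expR a *: P.
  by rewrite expR0 scale1r scalerBl scale1r addrA addrAC.
by apply: cvgD; (apply: cvgZr_tmp; exact: cvg_exp).
Qed.

Lemma ball_lawE (R : realType) (t : R) : ball_law t =
  \row_(i < 2) (if i == urn_a then stay_prob t else 1 - stay_prob t).
Proof.
(* The generator has eigenvalues [0] and [- 2], so its square is [- 2] times
   itself and dividing it by [- 2] gives a projection. *)
pose P : 'M[R]_2 := - 2^-1 *: ball_generator R.
have PP : P * P = P.
  apply/matrixP => i j; rewrite !mxE !big_ord_recl big_ord0 !mxE.
  by case: i j => [[|[|//]] ?] [[|[|//]] ?]; rewrite /=; field.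
have EQ : t *: ball_generator R = - (2 * t) *: P.
  by rewrite scalerA; congr (_ *: _); field.
rewrite /ball_law /ctmc_law EQ matrix_exp_scale_proj //.
apply/rowP => j; rewrite -rowE !mxE /stay_prob.
by case: j => [[|[|//]] ?]; rewrite /=; field.
Qed.

Lemma acos_sqrt_half (R : realType) (x : R) : -1 <= x <= 1 ->
  acos (Num.sqrt ((1 + x) / 2)) = acos x / 2.
Proof.
move=> x1; have := acos_ge0 x1; have := acos_lepi x1.
set y := acos x => y_pi y0.
have c0 : 0 <= cos (y / 2) by apply: cos_ge0_pihalf; lra.
have -> : (1 + x) / 2 = cos (y / 2) ^+ 2.
  have := cos_mulr2n (y / 2); rewrite -[_ / 2 *+ 2]mulr_natr divfK ?pnatr_eq0 //.
  rewrite acosK ?in_itv //= -mulr_natr; lra.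
by rewrite sqrtr_sqr ger0_norm // cosK // in_itv /=; lra.
Qed.

Lemma expR_Ndouble_itv01 (R : realType) (t : R) : 0 <= t ->
   0 <= expR (- (2 * t)) <= 1.
Proof.
by move=> t0; rewrite expR_ge0 /= -expR0 ler_expR oppr_le0 mulr_ge0.
Qed.

Theorem proposition7p12 (R : realType) (n : nat) (hn : (1 <= n)%N) :
  (largest_nonzero_eigenvalue (ehrenfest R n) (-2) /\
   (exists f : 'cV[R]_n.+1, slowest_nonconstant_mode (ehrenfest R n) 2 f)) /\
  forall t : R, 0 <= t ->
    [/\ cos (theta t) = expR (- (2 * t)),
        forall (gamma : R) (f : 'cV[R]_n.+1),
          slowest_nonconstant_mode (ehrenfest R n) gamma f ->
          expR (- (2 * t)) = relaxation_factor gamma t &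
    [/\ ball_law t =
          \row_(i < 2) (if i == urn_a then stay_prob t else 1 - stay_prob t),
        prob_vector (delta_a R) /\ prob_vector (ball_law t),
        BC (delta_a R) (ball_law t) = Num.sqrt (stay_prob t),
        statistical_angle (delta_a R) (ball_law t)
          = acos (Num.sqrt (stay_prob t)) &
        acos (Num.sqrt (stay_prob t)) = theta t / 2]].
Proof.
split.
  split; first exact: largest_ehrenfest.
  exists (imbalance R n); split; first exact: mode_imbalance.
  exact: largest_ehrenfest.
move=> t t0; have /andP[e0 e1] := expR_Ndouble_itv01 R t t0.
have p1 : 0 <= 1 - stay_prob t by rewrite /stay_prob; lra.
have p0 : 0 <= stay_prob t by rewrite /stay_prob; lra.
have BCE : BC (delta_a R) (ball_law t) = Num.sqrt (stay_prob t).
  rewrite ball_lawE /BC !big_ord_recl big_ord0 !mxE /=.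
  by rewrite mul1r mul0r sqrtr0 !addr0.
split.
- by rewrite acosK // in_itv /=; lra.
- move=> gamma f [_ Qg]; rewrite /relaxation_factor.
  have -> := largest_nonzero_eigenvalue_unique _ _ _ _ _ Qg (largest_ehrenfest R n hn).
  by rewrite mulNr.
split.
- exact: ball_lawE.
- rewrite ball_lawE; split; split.
  + by move=> i; rewrite mxE ler0n.
  + by rewrite !big_ord_recl big_ord0 !mxE /= !addr0.
  + by move=> i; rewrite mxE; case: ifP.
  + by rewrite !big_ord_recl big_ord0 !mxE /= addr0 subrKC.
- exact: BCE.
- by rewrite /statistical_angle BCE.
- by rewrite acos_sqrt_half //; lra.
Qed.
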